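(* Let $A$ be an integral domain and let $a_1^+, a_1^-, a_2^+, a_2^-, a_3^+, a_3^-$ be nonzero elements of $A$ such that, for every positive integer $n$, $\prod_{i=1}^3 (a_i^+)^n \neq \prod_{i=1}^3 (a_i^-)^n$. Let $\mathcal{F} = \mathrm{Frac}(A)(x_1,x_2,x_3)$ be the field of rational functions in three independent variables, and define elements of $\mathcal{F}$ by \[ x'_1 = \frac{a_1^+ x_2^3 + a_1^- x_3^3}{x_1}, \qquad x'_2 = \frac{a_2^+ x_3^3 + a_2^- x_1^3}{x_2}, \qquad x'_3 = \frac{a_3^+ x_1^3 + a_3^- x_2^3}{x_3}. \] Let $\mathcal{U}\subset\mathcal{F}$ be the intersection of Laurent polynomial rings \[ \mathcal{U} = A[x_1^{\pm}, x_2^{\pm}, x_3^{\pm}] \cap A[(x'_1)^{\pm}, x_2^{\pm}, x_3^{\pm}] \cap A[x_1^{\pm}, (x'_2)^{\pm}, x_3^{\pm}] \cap A[x_1^{\pm}, x_2^{\pm}, (x'_3)^{\pm}]. \] Then $\mathcal{U}$ is not finitely generated as an $A$-algebra.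
   Context: For elements $u,v,w\in\mathcal{F}$, $A[u^{\pm},v^{\pm},w^{\pm}]$ denotes the $A$-subalgebra of $\mathcal{F}$ generated by $u,u^{-1},v,v^{-1},w,w^{-1}$. *)

(* Defs.v *)
From HB Require Import structures.
From mathcomp Require Import all_boot all_order all_algebra.
From mathcomp Require Import mpoly.
Set Implicit Arguments.
Unset Strict Implicit.
Unset Printing Implicit Defensive.
Import GRing.Theory.
Local Open Scope ring_scope.

Section Subalgebra.
Variables (A L : comNzRingType) (iota : {rmorphism A -> L}).

(* [subalg iota S] is the A-subalgebra of [L] generated by [S], where [L] is an
   A-algebra through [iota].  Closure under opposites follows from the
   scalar -1. *)
Inductive subalg (S : L -> Prop) : L -> Prop :=
| subalg_scalar (a : A) : subalg S (iota a)
| subalg_gen (x : L) : S x -> subalg S x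
| subalg_add (x y : L) : subalg S x -> subalg S y -> subalg S (x + y)
| subalg_mul (x y : L) : subalg S x -> subalg S y -> subalg S (x * y).

Definition fin_gen_subalg (U : L -> Prop) : Prop :=
  exists s : seq L, forall x : L, U x <-> subalg (fun y => y \in s) x.

End Subalgebra.

Definition laurent (A : comNzRingType) (L : fieldType)
    (iota : {rmorphism A -> L}) (u v w : L) : L -> Prop :=
  subalg iota (fun y => y \in [:: u; u^-1; v; v^-1; w; w^-1]).

(* Frac(A)(x_1, x_2, x_3) *)
Definition ratfun3 (A : idomainType) : fieldType :=
  {fraction {mpoly {fraction A}[3]}}.

Definition ratfun3_scalar (A : idomainType) : {rmorphism A -> ratfun3 A} :=
  (@tofrac {mpoly {fraction A}[3]}) \o (@mpolyC 3 {fraction A}) \o (@tofrac A).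

(* 'I_3 starts at 0, so x_1 is [ratfun3_var A 0] and x_3 is [ratfun3_var A 2]. *)
Definition ratfun3_var (A : idomainType) (i : 'I_3) : ratfun3 A :=
  tofrac ('X_i : {mpoly {fraction A}[3]}).

(* Main.v *)
Require Import Defs.
From HB Require Import structures.
From mathcomp Require Import all_boot all_order all_algebra.
From mathcomp Require Import mpoly.
From mathcomp Require Import zify ring.
Import GRing.Theory.
Local Open Scope ring_scope.
Set Implicit Arguments.
Unset Strict Implicit.

(** Everything is graded by total degree, each x_i having degree 1, and an
    element of U is p / (x_1 x_2 x_3)^N for some polynomial p; its part of
    degree d comes from the monomials of p of degree 3 N + d.  The theorem
    follows from two facts over K = Frac(A).
    - The parts of negative degree vanish and the part of degree 0 is constant
      ([low_degree_bound]).
    - The part of degree 1 of U has poles of arbitrarily high order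
      ([degree_one_element]).
    Given the first fact, the part of degree 1 of a polynomial in finitely many
    elements of U is a linear combination of the parts of degree 1 of these
    elements, so the order of its poles is bounded by the generators
    ([small_poles_subalg], [small_poles_elt_bound]).  This contradicts the
    second fact.

    Both facts rest on a criterion for membership in U.  Indices are cyclic,
    i+1 and i+2 being [ordS i] and [ord_pred i].  Order p by powers of x_i.
    Since x_i x_i' = a_i^+ x_{i+1}^3 + a_i^- x_{i+2}^3, the quotient
    p / (x_1 x_2 x_3)^N is a Laurent polynomial in x_i', x_{i+1}, x_{i+2} iff,
    for all j < N, the coefficient of x_i^j in p is divisible by the
    (N - j)-th power of that binomial
    ([laurent_mut_divisible], [divisible_laurent_mut]).  The coefficient is
    divisible iff its homogeneous components are, and these dehomogenize to
    polynomials in one variable t = x_{i+1} / x_{i+2}, here called slices; the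
    binomial becomes the edge polynomial a_i^+ t^3 + a_i^- of degree 3.

    For the first fact, let j < N and suppose that every x_k divides to order
    at least j the terms of p of degree e <= 3 N.  The slice for x_i^j is t^j
    times a polynomial of degree at most e - 3 j that is divisible by a
    polynomial of degree 3 (N - j).  So it vanishes if e < 3 N, and otherwise
    it is a constant c_i times t^j times the (N - j)-th power of the edge
    polynomial.  Two neighbouring slices share a corner monomial, whence
    c_i (a_i^+)^(N-j) = c_{i+2} (a_{i+2}^-)^(N-j).  The product over i of these
    three relations and the hypothesis on the a_i give c_i = 0.

    For the second fact, p is built layer by layer, a layer being the monomials
    whose smallest exponent is j.  On the side x_i^j of the triangle of
    monomials of layer j, the 3 (N - j) interior monomials suffice to correct
    the slice modulo a polynomial of degree 3 (N - j) prime to t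
    ([edge_correction]), without changing the earlier layers or the other two
    sides ([layer_induction]). *)

(** * Slices of a polynomial along a coordinate *)

Lemma ordS_neq (i : 'I_3) : (ordS i == i) = false.
Proof. by case: i => [[|[|[|]]]]. Qed.

Lemma ord_pred_neq (i : 'I_3) : (ord_pred i == i) = false.
Proof. by case: i => [[|[|[|]]]]. Qed.

Lemma ord_pred_neqS (i : 'I_3) : (ord_pred i == ordS i) = false.
Proof. by case: i => [[|[|[|]]]]. Qed.

Lemma ordSS (i : 'I_3) : ordS (ordS i) = ord_pred i.
Proof. by apply/val_inj; case: i => [[|[|[|]]]]. Qed.

Lemma ord3_cases (i k : 'I_3) : [\/ k = i, k = ordS i | k = ord_pred i].
Proof.
have: [|| k == i, k == ordS i | k == ord_pred i].
  by case: i => [[|[|[|]]]] // ?; case: k => [[|[|[|]]]].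
by case/or3P => /eqP ->; [constructor 1 | constructor 2 | constructor 3].
Qed.

(** Symmetric expressions in the three variables are expanded around a chosen
    index, so that each argument is written for one index only. *)
Lemma big_cyc (T : Type) (idx : T) (op : Monoid.com_law idx) (G : 'I_3 -> T) i :
  \big[op/idx]_(k < 3) G k = op (G i) (op (G (ordS i)) (G (ord_pred i))).
Proof.
rewrite (bigD1 i) //=; congr (op _ _).
rewrite (bigD1 (ordS i)) ?ordS_neq //=; congr (op _ _).
rewrite (bigD1 (ord_pred i)) ?ord_pred_neq ?ord_pred_neqS //=.
rewrite big1 ?Monoid.mulm1 // => k.
by case: i => [[|[|[|]]]] // ?; case: k => [[|[|[|]]]].
Qed.

Lemma mdeg_cyc (m : 'X_{1..3}) i :
  mdeg m = (m i + (m (ordS i) + m (ord_pred i)))%N.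
Proof. by rewrite mdegE (big_cyc _ _ i). Qed.

Lemma mnm_cycP (m m' : 'X_{1..3}) i :
  m i = m' i -> m (ordS i) = m' (ordS i) -> mdeg m = mdeg m' -> m = m'.
Proof.
move=> e1 e2; rewrite !(mdeg_cyc _ i) e1 e2 => /addnI/addnI e3.
by apply/mnmP => k; case: (ord3_cases i k) => ->.
Qed.

Section Slice.
Variable K : fieldType.
Implicit Types (p : {mpoly K[3]}) (m : 'X_{1..3}) (i : 'I_3).

Definition chart_const : {rmorphism K -> {poly {poly {poly K}}}} :=
  polyC \o polyC \o polyC.

(** The chart x_i = s l, x_{i+1} = t l, x_{i+2} = l, in K[t][l][s]: then l records
    the total degree, s the exponent of x_i, and the exchange binomial of x_i is
    l^3 times a polynomial in t alone. *)
Definition chart_var i (k : 'I_3) : {poly {poly {poly K}}} :=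
  if k == i then 'X%:P * 'X else if k == ordS i then ('X * 'X%:P)%:P
  else 'X%:P.

Definition chart i : {rmorphism {mpoly K[3]} -> {poly {poly {poly K}}}} :=
  mmap chart_const (chart_var i).

(** The coefficient of x_i^j in the component of degree e of p, dehomogenized
    by t = x_{i+1} / x_{i+2}. *)
Definition slice i p (j e : nat) : {poly K} := (chart i p)`_j`_e.

Lemma chartX i m :
  chart i 'X_[m] = ('X^(m (ordS i)) *: 'X^(mdeg m)) *: 'X^(m i).
Proof.
rewrite /chart /= mmapX /mmap1 (big_cyc _ _ i) /chart_var !eqxx.
rewrite ordS_neq ord_pred_neq ord_pred_neqS (mdeg_cyc _ i) /=.
rewrite -!mul_polyC -!rmorphXn /= !exprMn !rmorphM -!rmorphXn /= !exprD.
rewrite !rmorphM /= !rmorphXn /=. ring.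
Qed.

Lemma chartC i c : chart i c%:MP = c%:P%:P%:P.
Proof. by rewrite /chart /= mmapC. Qed.

Lemma chartZX i (c : K) m :
  chart i (c *: 'X_[m]) = (c *: 'X^(m (ordS i)) *: 'X^(mdeg m)) *: 'X^(m i).
Proof.
by rewrite -mul_mpolyC rmorphM /= chartX chartC -!mul_polyC !rmorphM /= !mulrA.
Qed.

Lemma sliceD i p q j e : slice i (p + q) j e = slice i p j e + slice i q j e.
Proof. by rewrite /slice rmorphD !coefD. Qed.

Lemma slice_sum i I (r : seq I) (P : pred I) (G : I -> {mpoly K[3]}) j e :
  slice i (\sum_(k <- r | P k) G k) j e = \sum_(k <- r | P k) slice i (G k) j e.
Proof. by rewrite /slice rmorph_sum !coef_sum. Qed.

Lemma sliceZX i (c : K) m j e :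
  slice i (c *: 'X_[m]) j e =
  (c * ((m i == j) && (mdeg m == e))%:R) *: 'X^(m (ordS i)).
Proof.
rewrite /slice chartZX coefZ coefXn eq_sym.
case: eqP => _ /=; last by rewrite mulr0 coef0 mulr0 scale0r.
rewrite mulr1 coefZ coefXn eq_sym.
by case: eqP => _ /=; rewrite ?mulr1 // !mulr0 scale0r.
Qed.

Lemma slice_coef i p m :
  (slice i p (m i) (mdeg m))`_(m (ordS i)) = p@_m.
Proof.
rewrite {1 2}[p]mpolyE slice_sum coef_sum raddf_sum /=.
apply: eq_bigr => m' _; rewrite sliceZX coefZ coefXn mcoeffZ mcoeffX.
rewrite -mulrA -natrM mulnb; congr (_ * (nat_of_bool _)%:R).
apply/idP/idP => [|/eqP -> ]; last by rewrite !eqxx.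
by case/andP=> /andP[/eqP e1 /eqP e2] /eqP e3; apply/eqP/(@mnm_cycP _ _ i).
Qed.

Lemma slice_coef_neq0 i p j e b :
  (slice i p j e)`_b != 0 ->
  exists2 m, m \in msupp p & [/\ m i = j, mdeg m = e & m (ordS i) = b].
Proof.
rewrite {1}[p]mpolyE slice_sum coef_sum => nz.
case: (boolP (has (fun m => [&& m i == j, mdeg m == e & m (ordS i) == b])
  (msupp p))) => [/hasP[m mp /and3P[/eqP ? /eqP ? /eqP ?]]|/hasPn h].
  by exists m.
case/negP: nz; apply/eqP/big1_seq => m /andP[_ /h].
rewrite sliceZX coefZ coefXn (eq_sym b) -mulrA -natrM mulnb -andbA.
by move/negbTE => ->; rewrite mulr0.
Qed.

End Slice.

(** * The part of nonpositive degree *)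

Section LowDegree.
Variables (K : fieldType) (al be : 'I_3 -> K).
Hypothesis al_neq0 : forall i, al i != 0.
Hypothesis be_neq0 : forall i, be i != 0.
Implicit Types (p : {mpoly K[3]}) (m : 'X_{1..3}) (i : 'I_3).

(** The exchange binomial of x_i, dehomogenized by t = x_{i+1} / x_{i+2}. *)
Definition edge i : {poly K} := al i *: 'X^3 + (be i)%:P.

Lemma size_edge i : size (edge i) = 4.
Proof.
by rewrite /edge size_polyDl size_scale ?size_polyXn // size_polyC; case: eqP.
Qed.

Lemma edge_neq0 i : edge i != 0.
Proof. by rewrite -size_poly_eq0 size_edge. Qed.

Lemma lead_coef_edge i : lead_coef (edge i) = al i.
Proof.
rewrite /edge lead_coefDl ?lead_coefZ ?lead_coefXn ?mulr1 //.
by rewrite size_scale // size_polyXn size_polyC; case: eqP.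
Qed.

Lemma size_edge_exp i k : size (edge i ^+ k) = (3 * k).+1.
Proof.
have := size_exp (edge i) k; rewrite size_edge /= => <-.
by rewrite prednK // size_poly_gt0 expf_neq0 ?edge_neq0.
Qed.

Lemma edge_exp_coef0 i k : (edge i ^+ k)`_0 = be i ^+ k.
Proof. by rewrite -horner_coef0 /edge !hornerE /= mulr0 add0r. Qed.

Lemma edge_exp_coef_top i k : (edge i ^+ k)`_(3 * k) = al i ^+ k.
Proof. by rewrite -lead_coef_edge -lead_coef_exp lead_coefE size_edge_exp. Qed.

Definition edge_divisible N p :=
  forall i j e, (j < N)%N -> edge i ^+ (N - j) %| slice i p j e.

Lemma coprimep_Xn_edge i a k : coprimep ('X^a) (edge i ^+ k).
Proof.
apply/coprimep_expl/coprimep_expr.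
rewrite coprimep_sym -[X in coprimep _ X]subr0 coprimep_XsubC rootE.
by rewrite /edge !hornerE /= mulr0 add0r.
Qed.

(** By the hypothesis on the monomials the slice is t^j times a polynomial of
    degree at most e - 3 j <= 3 (N - j), which leaves a constant cofactor to
    [edge i ^+ (N - j)]. *)
Lemma slice_low_degree N p i j e :
  edge_divisible N p -> (j < N)%N -> (e <= 3 * N)%N ->
  (forall m, m \in msupp p -> mdeg m = e -> forall k, (j <= m k)%N) ->
  exists2 c, slice i p j e = c *: ('X^j * edge i ^+ (N - j)) &
             (e < 3 * N)%N -> c = 0.
Proof.
move=> /(_ i j e) dv ltjN lee hm.
set s := slice i p j e; pose tau := \poly_(b < (e - 3 * j).+1) s`_(b + j).
have sE : s = 'X^j * tau.
  apply/polyP => b; rewrite coefXnM coef_poly.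
  case: ltnP => [ltbj|lejb].
    apply/eqP; apply: contraTT ltbj => /slice_coef_neq0 [m mp [mi mdm <-]].
    by rewrite -leqNgt hm.
  rewrite subnK //; case: ltnP => // h.
  apply/eqP; apply: contraTT h => /slice_coef_neq0 [m mp [mi mdm bE]].
  have := hm m mp mdm (ord_pred i); move: mdm; rewrite (mdeg_cyc _ i); lia.
have := dv ltjN; rewrite -/s sE Gauss_dvdpr; last first.
  by rewrite coprimep_sym coprimep_Xn_edge.
case/dvdpP => ka tauE.
have sz : (size tau <= (e - 3 * j).+1)%N by apply: size_poly.
case: (eqVneq ka 0) => [ka0|ka0].
  by exists 0 => //; rewrite tauE ka0 mul0r mulr0 scale0r.
move: sz; rewrite tauE size_mul ?expf_neq0 ?edge_neq0 // size_edge_exp => sz.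
have ska : (size ka <= 1)%N by move: sz ltjN lee; rewrite addnS /=; move: (size _) => z; clear; lia.
have := ska; rewrite leq_eqVlt ltnS leqn0 size_poly_eq0 (negbTE ka0) orbF.
move=> /eqP ska1; exists ka`_0; last first.
  by move: sz; rewrite ska1 => sz lte; exfalso; move: sz ltjN lte; clear; lia.
by rewrite {1}(size1_polyC ska) mul_polyC -scalerAr.
Qed.

Hypothesis prod_neq :
  forall k, (0 < k)%N -> \prod_i al i ^+ k <> \prod_i be i ^+ k.

(** The monomial with exponents j at k and k+2 lies on the sides of k and of
    k+2; comparing its coefficient in both slices links their constants, and
    the three links are compatible only if all the constants are 0. *)
Lemma low_degree_step N p j e :
  edge_divisible N p -> (j < N)%N -> (e <= 3 * N)%N ->
  (forall m, m \in msupp p -> mdeg m = e -> forall k, (j <= m k)%N) ->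
  forall i, slice i p j e = 0.
Proof.
move=> dv ltjN lee hm.
have /fin_all_exists2 [c cE c0] :=
  fun i => slice_low_degree i dv ltjN lee hm.
suff h i : c i = 0 by move=> i; rewrite cE h scale0r.
move: lee; rewrite leq_eqVlt => /predU1P [eE|/c0 //].
have rot k : c k * al k ^+ (N - j) = c (ord_pred k) * be (ord_pred k) ^+ (N - j).
  (* the corner monomial shared by the sides of k and of k + 2 *)
  pose m := [multinom (if l == ordS k then 3 * (N - j) + j else j)%N | l < 3].
  have [mk mSk mPk] : [/\ m k = j, m (ordS k) = (3 * (N - j) + j)%N
                       & m (ord_pred k) = j].
    by rewrite !mnmE eqxx ord_pred_neqS eq_sym ordS_neq.
  have dm : mdeg m = e by rewrite (mdeg_cyc _ k) mk mSk mPk; lia.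
  transitivity p@_m.
    rewrite -(slice_coef k) dm mk mSk cE coefZ coefXnM ifF; last by lia.
    by rewrite addnK edge_exp_coef_top.
  rewrite -(slice_coef (ord_pred k)) dm mPk cE coefZ coefXnM ord_predK mk ltnn.
  by rewrite subnn edge_exp_coef0.
have kgt0 : (0 < N - j)%N by rewrite subn_gt0.
have pc : \prod_k c k = 0.
  apply/eqP/negPn/negP => nz; apply: (prod_neq kgt0); apply: (mulfI nz).
  rewrite -!big_split /= (eq_bigr _ (fun k _ => rot k)).
  by rewrite [RHS](reindex_inj (@ord_pred_inj 3)).
have prop k : c k = 0 -> c (ordS k) = 0.
  move=> ck0; have /eqP := rot (ordS k); rewrite ordSK ck0.
  by rewrite mul0r mulf_eq0 expf_eq0 (negbTE (al_neq0 _)) andbF orbF => /eqP.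
have /prodf_eq0[k _ /eqP ck0] : \prod_(k | true) c k == 0 by rewrite pc.
case: (ord3_cases k i) => ->; rewrite -?ordSS; auto.
Qed.

Lemma low_degree_bound N p m :
  edge_divisible N p -> m \in msupp p -> (mdeg m <= 3 * N)%N ->
  forall i, (N <= m i)%N.
Proof.
move=> dv mp le_m i; suff: forall j, (j <= N)%N -> forall m, m \in msupp p ->
  (mdeg m <= 3 * N)%N -> forall i, (j <= m i)%N by apply.
elim=> [//|j IH] ltjN {}m {}mp {}le_m {}i.
have le_j k : (j <= m k)%N by apply: IH => //; apply: ltnW.
rewrite ltn_neqAle le_j andbT; apply: contraTneq mp => mi.
rewrite mcoeff_msupp negbK -(slice_coef i) -mi.
rewrite (low_degree_step dv ltjN le_m) ?coef0 //.
by move=> m' m'p dm'; apply: IH => //; [apply: ltnW | rewrite dm'].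
Qed.

End LowDegree.

(** * Elements of degree one with large poles *)

Section DegreeOne.
Variables (K : fieldType) (al be : 'I_3 -> K).
Hypothesis al_neq0 : forall i, al i != 0.
Hypothesis be_neq0 : forall i, be i != 0.
Variable N : nat.
Implicit Types (p : {mpoly K[3]}) (m : 'X_{1..3}) (i : 'I_3).
Local Notation edge := (edge al be).

(** As t is invertible modulo [edge i ^+ k], the class of w is determined; its
    remainder has size at most the degree 3 k. *)
Lemma edge_correction i a k (sigma : {poly K}) :
  exists2 w : {poly K}, (size w <= 3 * k)%N & edge i ^+ k %| sigma + 'X^a * w.
Proof.
have /Bezout_eq1_coprimepP [u uE] := coprimep_Xn_edge al be_neq0 i a k.
set Q := edge i ^+ k in uE *.
have Q0 : Q != 0 by rewrite expf_neq0 // edge_neq0.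
pose v := - (u.1 * sigma); exists (v %% Q).
  by rewrite -ltnS -(size_edge_exp be al_neq0 i) ltn_modp.
apply/dvdpP; exists (u.2 * sigma - 'X^a * (v %/ Q)).
have modE : v %% Q = v - v %/ Q * Q by rewrite {2}(divp_eq v Q) addrC addKr.
have sE : sigma = (u.1 * 'X^a + u.2 * Q) * sigma by rewrite uE mul1r.
by rewrite modE {1}sE /v; ring.
Qed.

(** The monomial of degree 3 N + 1 with exponents j at i and b at i+1. *)
Definition side_mon i j b : 'X_{1..3} :=
  [multinom (if l == i then j else if l == ordS i then b
             else 3 * N + 1 - j - b)%N | l < 3].

Lemma side_monE i j b :
  [/\ side_mon i j b i = j, side_mon i j b (ordS i) = b
    & side_mon i j b (ord_pred i) = (3 * N + 1 - j - b)%N].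
Proof. by rewrite !mnmE !eqxx ordS_neq ord_pred_neq ord_pred_neqS. Qed.

Lemma mdeg_side_mon i j b : (j + b <= 3 * N + 1)%N ->
  mdeg (side_mon i j b) = (3 * N + 1)%N.
Proof. by rewrite (mdeg_cyc _ i); case: (side_monE i j b) => -> -> ->; lia. Qed.

Lemma side_mon_gt i j b k : (b < 3 * (N - j))%N -> k != i ->
  (j < side_mon i j (j.+1 + b) k)%N.
Proof.
move=> ltb; case: (ord3_cases i k) => ->; first by rewrite eqxx.
all: by case: (side_monE i j (j.+1 + b)) => _ mS mP _; rewrite ?mS ?mP; lia.
Qed.

(** A combination of the interior monomials of the side x_i^j of layer j: their
    other two exponents exceed j. *)
Definition side i j (w : {poly K}) : {mpoly K[3]} :=
  \sum_(b < 3 * (N - j)) w`_b *: 'X_[side_mon i j (j.+1 + b)].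

Lemma mdeg_side i j (b : 'I_(3 * (N - j))) :
  mdeg (side_mon i j (j.+1 + b)) = (3 * N + 1)%N.
Proof. by apply: mdeg_side_mon; case: b => b /= ?; lia. Qed.

Lemma slice_side i j (w : {poly K}) : (size w <= 3 * (N - j))%N ->
  slice i (side i j w) j (3 * N + 1) = 'X^(j.+1) * w.
Proof.
move=> szw; rewrite slice_sum.
have -> : 'X^(j.+1) * w = \sum_(b < 3 * (N - j)) w`_b *: 'X^(j.+1 + b).
  rewrite -{1}(coefK w) poly_def mulr_sumr (big_ord_widen _ (fun b => 'X^(j.+1) * (w`_b *: 'X^b)) szw).
  rewrite big_mkcond /=; apply: eq_bigr => b _.
  case: ltnP => [_|le_b]; first by rewrite -scalerAr -exprD.
  by rewrite nth_default // scale0r.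
apply: eq_bigr => b _; rewrite sliceZX mdeg_side eqxx andbT.
by case: (side_monE i j (j.+1 + b)) => -> -> _; rewrite eqxx mulr1.
Qed.

Lemma slice_side0 i j (w : {poly K}) k j' e : (j' < j)%N || (j' == j) && (k != i) ->
  slice k (side i j w) j' e = 0.
Proof.
move=> h; rewrite slice_sum big1 // => b _; rewrite sliceZX.
case: eqP => [mj|]; last by rewrite mulr0 scale0r.
suff: false by []; case/orP: h => [ltj'|/andP[/eqP j'E ki]].
  case: (eqVneq k i) mj => [->|ki]; first by case: (side_monE i j (j.+1 + b)) => ->; lia.
  by have := side_mon_gt (ltn_ord b) ki; lia.
by have := side_mon_gt (ltn_ord b) ki; lia.
Qed.

(** The corner x_3^(3 N + 1) belongs to no interior of a side, so its coefficient
    keeps the value 1 throughout the construction. *)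
Lemma layer_induction J : (J <= N)%N -> exists p,
  [/\ forall m, mdeg m != (3 * N + 1)%N -> p@_m = 0,
      forall i j, (j < J)%N -> edge i ^+ (N - j) %| slice i p j (3 * N + 1)
    & p@_(side_mon ord0 0 0) = 1].
Proof.
elim: J => [_|J IH ltJN].
  exists 'X_[side_mon ord0 0 0]; split=> // [m dm|]; rewrite mcoeffX ?eqxx //.
  by case: (_ =P m) dm => [<-|//]; rewrite mdeg_side_mon ?eqxx.
have [p [hom dv p1]] := IH (ltnW ltJN).
have /fin_all_exists2 [w szw dvw] :=
  fun i => edge_correction i J.+1 (N - J) (slice i p J (3 * N + 1)).
exists (p + \sum_i side i J (w i)); split=> [m dm|i j|].
- rewrite mcoeffD hom // add0r raddf_sum big1 //= => i _.
  rewrite raddf_sum big1 //= => b _; rewrite mcoeffZ mcoeffX.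
  by case: (_ =P m) dm => [<-|]; rewrite ?mulr0 // mdeg_side eqxx.
- rewrite ltnS leq_eqVlt sliceD slice_sum => /predU1P[->|ltj].
    rewrite (bigD1 i) //= slice_side ?szw // big1 ?addr0 // => k ki.
    by rewrite slice_side0 // eqxx eq_sym ki orbT.
  by rewrite big1 ?addr0 ?dv // => k _; rewrite slice_side0 // ltj.
- rewrite mcoeffD p1 raddf_sum big1 ?addr0 //= => i _.
  rewrite raddf_sum big1 //= => b _; rewrite mcoeffZ mcoeffX.
  case: eqP => [E|_]; last by rewrite mulr0.
  have gt k := @side_mon_gt i J b k (ltn_ord b).
  have := gt ord0; have := gt (ordS ord0); rewrite E.
  case: (side_monE ord0 0 0) => -> -> _; rewrite !ltn0 => h1 h2.
  case: (eqVneq ord0 i) h1 h2 => [<-|_] h1 h2; last by have := h2 isT.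
  by rewrite ordS_neq in h1; have := h1 isT.
Qed.

Lemma degree_one_element : exists p,
  edge_divisible al be N p /\
  exists m, [/\ m \in msupp p, mdeg m = (3 * N + 1)%N & m ord0 = 0%N].
Proof.
have [p [hom dv p1]] := layer_induction (leqnn N); exists p; split.
  move=> i j e ltj; case: (eqVneq e (3 * N + 1)%N) => [->|ne]; first exact: dv.
  rewrite (_ : slice i p j e = 0) ?dvdp0 //; apply/polyP => b; rewrite coef0.
  apply/eqP/negPn/negP => /slice_coef_neq0 [m mp [_ dm _]]; move: mp.
  by rewrite mcoeff_msupp hom ?dm ?eqxx.
exists (side_mon ord0 0 0); split; last by case: (side_monE ord0 0 0).
  by rewrite mcoeff_msupp p1 oner_neq0.
exact: mdeg_side_mon.
Qed.

End DegreeOne.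

(** * Laurent polynomials in a mutated cluster are divisible *)

Section SubalgTheory.
Variables (A L : comNzRingType) (iota : {rmorphism A -> L}) (S : L -> Prop).

Lemma subalg1 : subalg iota S 1.
Proof. by rewrite -(rmorph1 iota); apply: subalg_scalar. Qed.

Lemma subalg0 : subalg iota S 0.
Proof. by rewrite -(rmorph0 iota); apply: subalg_scalar. Qed.

Lemma subalg_exp x n : subalg iota S x -> subalg iota S (x ^+ n).
Proof.
move=> Sx; elim: n => [|n IH]; first exact: subalg1.
by rewrite exprS; apply: subalg_mul.
Qed.

Lemma subalg_sum I (r : seq I) (P : pred I) (G : I -> L) :
  (forall k, P k -> subalg iota S (G k)) ->
  subalg iota S (\sum_(k <- r | P k) G k).
Proof.
by move=> h; apply: big_ind h; [exact: subalg0 | exact: subalg_add].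
Qed.

End SubalgTheory.

Lemma subalg_sub (A L : comNzRingType) (iota : {rmorphism A -> L})
    (S T : L -> Prop) :
  (forall x, S x -> T x) -> forall x, subalg iota S x -> subalg iota T x.
Proof.
move=> sub x; elim=> {x} [a|x /sub|x y _ ? _ ?|x y _ ? _ ?].
- exact: subalg_scalar.
- exact: subalg_gen.
- exact: subalg_add.
- exact: subalg_mul.
Qed.

Section Criterion.
Variables (K : fieldType) (al be : 'I_3 -> K).
Hypothesis al_neq0 : forall i, al i != 0.
Hypothesis be_neq0 : forall i, be i != 0.
Implicit Types (p r : {mpoly K[3]}) (m : 'X_{1..3}) (i : 'I_3).
Local Notation F := {fraction {mpoly K[3]}}.
Local Notation edge := (edge al be).
Local Notation frac := (@tofrac {mpoly K[3]}).
Local Notation chart := (chart K).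

Definition scal : {rmorphism K -> F} := frac \o (@mpolyC 3 K).

Definition var i : F := frac 'X_i.

Definition exch i : {mpoly K[3]} :=
  al i *: 'X_(ordS i) ^+ 3 + be i *: 'X_(ord_pred i) ^+ 3.

Definition mut i : F := frac (exch i) / var i.

(** 'X_[diag N] is (x_1 x_2 x_3)^N, the denominator to which all elements are
    brought. *)
Definition diag N : 'X_{1..3} := [multinom N | _ < 3].

Lemma diagE N i : diag N i = N.
Proof. exact: mnmE. Qed.

Lemma mdeg_diag N : mdeg (diag N) = (3 * N)%N.
Proof. by rewrite (mdeg_cyc _ ord0) !diagE; lia. Qed.

Lemma diagD N N' : diag (N + N') = (diag N + diag N')%MM.
Proof. by apply/mnmP => i; rewrite mnmDE !diagE. Qed.

Lemma diag0 : diag 0 = 0%MM.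
Proof. by []. Qed.

Lemma mpolyX_cyc m i : 'X_[m] = 'X_i ^+ m i * 'X_(ordS i) ^+ m (ordS i) *
  'X_(ord_pred i) ^+ m (ord_pred i) :> {mpoly K[3]}.
Proof. by rewrite mpolyXE_id (big_cyc _ _ i) /= mulrA. Qed.

Lemma frac_diag N i : frac 'X_[diag N] =
  var i ^+ N * var (ordS i) ^+ N * var (ord_pred i) ^+ N.
Proof. by rewrite (mpolyX_cyc _ i) !diagE !rmorphM !rmorphXn. Qed.

Lemma var_neq0 i : var i != 0.
Proof.
rewrite /var tofrac_eq0; apply/eqP => /(congr1 (mcoeff U_(i))) /eqP.
by rewrite mcoeffX eqxx mcoeff0 oner_eq0.
Qed.

Lemma frac_diag_neq0 N : frac 'X_[diag N] != 0.
Proof. by rewrite (frac_diag N ord0) !mulf_neq0 ?expf_neq0 ?var_neq0. Qed.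

Lemma chart_var_eq i k : chart i 'X_k = chart_var K i k.
Proof. by rewrite /chart /= mmapX mmap1U. Qed.

Lemma chart_exch i : chart i (exch i) = ((edge i)%:P * 'X ^+ 3)%:P.
Proof.
rewrite /exch rmorphD -!mul_mpolyC !(rmorphXn, rmorphM) !chartC.
rewrite !chart_var_eq /chart_var ordS_neq ord_pred_neq ord_pred_neqS eqxx.
rewrite /edge -mul_polyC !(rmorphM, rmorphD, rmorphXn) /=. ring.
Qed.

Lemma exch_neq0 i : exch i != 0.
Proof.
apply/eqP => /(congr1 (chart i)); rewrite chart_exch rmorph0 => /eqP.
by rewrite polyC_eq0 mulf_eq0 polyC_eq0 (negbTE (edge_neq0 be al_neq0 i)) expf_eq0 /= polyX_eq0.
Qed.

Lemma mut_neq0 i : mut i != 0.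
Proof. by rewrite mulf_neq0 ?invr_eq0 ?var_neq0 // tofrac_eq0 exch_neq0. Qed.

(** Vanishing to order at least k along the curve where x_i and its exchange
    binomial are both 0: in the chart, membership in the k-th power of the
    ideal generated by s and [edge i]. *)
Definition edge_order i k r :=
  forall c, exists q, (chart i r)`_c = (edge i ^+ (k - c))%:P * q.

Lemma edge_order0 i r : edge_order i 0 r.
Proof. by move=> c; exists (chart i r)`_c; rewrite sub0n expr0 mul1r. Qed.

Lemma edge_order_var i : edge_order i 1 'X_i.
Proof.
move=> c; rewrite chart_var_eq /chart_var eqxx coefMX.
case: c => [|c] /=; first by exists 0; rewrite mulr0.
by rewrite subSS sub0n; exists ('X%:P : {poly {poly {poly K}}})`_c; rewrite mul1r.
Qed.

Lemma edge_order_exch i : edge_order i 1 (exch i).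
Proof.
move=> c; rewrite chart_exch coefC.
case: c => [|c] /=; first by exists ('X^3).
by exists 0; rewrite mulr0.
Qed.

Lemma edge_orderD i k r r' : edge_order i k r -> edge_order i k r' -> edge_order i k (r + r').
Proof.
move=> h h' c; have [q qE] := h c; have [q' q'E] := h' c.
by exists (q + q'); rewrite rmorphD coefD qE q'E mulrDr.
Qed.

Lemma edge_orderM i k k' r r' : edge_order i k r -> edge_order i k' r' -> edge_order i (k + k') (r * r').
Proof.
move=> h h' c; rewrite rmorphM coefM.
have /fin_all_exists [q qE] : forall a : 'I_c.+1, exists q,
    (chart i r)`_a * (chart i r')`_(c - a) = (edge i ^+ (k + k' - c))%:P * q.
  move=> a; have [q ->] := h a; have [q' ->] := h' (c - a)%N.
  exists ((edge i ^+ (k - a + (k' - (c - a)) - (k + k' - c)))%:P * (q * q')).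
  rewrite [RHS]mulrA -rmorphM -exprD /= mulrACA -rmorphM -exprD.
  by congr (_%:P * _); congr (_ ^+ _); have := ltn_ord a; lia.
by exists (\sum_a q a); rewrite mulr_sumr; apply: eq_bigr => a _; apply: qE.
Qed.

Lemma edge_orderX i k r n : edge_order i k r -> edge_order i (k * n) (r ^+ n).
Proof.
move=> h; elim: n => [|n IH]; first by rewrite muln0; apply: edge_order0.
by rewrite mulnS exprS; apply: edge_orderM.
Qed.

(** The common denominators of Laurent polynomials in x_i', x_{i+1}, x_{i+2}. *)
Definition den i L M M' : {mpoly K[3]} :=
  'X_i ^+ L * exch i ^+ M * ('X_(ordS i) * 'X_(ord_pred i)) ^+ M'.

Lemma edge_order_den i L M M' : edge_order i (L + M) (den i L M M').
Proof.
rewrite -[(L + M)%N]addn0; apply: edge_orderM; last exact: edge_order0.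
rewrite -[L]mul1n -[M]mul1n; apply: edge_orderM; rewrite ?mul1n.
  by rewrite -{1}[L]mul1n; apply/edge_orderX/edge_order_var.
by rewrite -{1}[M]mul1n; apply/edge_orderX/edge_order_exch.
Qed.

Lemma denM i L M M' L1 M1 M1' :
  den i L M M' * den i L1 M1 M1' = den i (L + L1) (M + M1) (M' + M1').
Proof. by rewrite /den !exprD; ring. Qed.

Lemma den000 i : den i 0 0 0 = 1.
Proof.
rewrite /den; move: (exch i) (_ * 'X_(ord_pred i)) => a b.
by rewrite !expr0 !mulr1.
Qed.

Lemma den100 i : den i 1 0 0 = 'X_i.
Proof.
rewrite /den; move: (exch i) (_ * 'X_(ord_pred i)) => a b.
by rewrite expr1 !expr0 !mulr1.
Qed.

Lemma den010 i : den i 0 1 0 = exch i.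
Proof.
rewrite /den; move: (exch i) (_ * 'X_(ord_pred i)) => a b.
by rewrite expr1 !expr0 mul1r mulr1.
Qed.

Lemma den001 i : den i 0 0 1 = 'X_(ordS i) * 'X_(ord_pred i).
Proof.
rewrite /den; move: (exch i) (_ * 'X_(ord_pred i)) => a b.
by rewrite expr1 !expr0 !mul1r.
Qed.

(** The generators x_i' = exch i / 'X_i and x_i'^-1 = 'X_i / exch i have
    numerator and denominator of the same order 1, and the other generators do
    not involve x_i or its exchange binomial. *)
Lemma laurent_mut_order i y :
  laurent scal (mut i) (var (ordS i)) (var (ord_pred i)) y ->
  exists L M M' r, y * frac (den i L M M') = frac r /\ edge_order i (L + M) r.
Proof.
elim=> {y} [a|y|y y' _ [L [M [M' [r [yE rP]]]]] _ [L1 [M1 [M1' [r1 [y1E r1P]]]]]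
  |y y' _ [L [M [M' [r [yE rP]]]]] _ [L1 [M1 [M1' [r1 [y1E r1P]]]]]].
- exists 0%N, 0%N, 0%N, a%:MP; split; last exact: edge_order0.
  by rewrite den000 tofrac1 mulr1.
- have vS := var_neq0 (ordS i); have vP := var_neq0 (ord_pred i).
  have vi := var_neq0 i.
  have ve : frac (exch i) != 0 by rewrite tofrac_eq0 exch_neq0.
  rewrite !inE => /or4P[/eqP-> | /eqP-> | /eqP-> | /or3P[/eqP-> | /eqP-> | /eqP->]].
  + exists 1%N, 0%N, 0%N, (exch i); split; last exact: edge_order_exch.
    by rewrite den100 /mut -/(var i) (divfK vi).
  + exists 0%N, 1%N, 0%N, 'X_i; split; last exact: edge_order_var.
    by rewrite den010 /mut invf_div (divfK ve).
  + exists 0%N, 0%N, 0%N, 'X_(ordS i); split; last exact: edge_order0.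
    by rewrite den000 tofrac1 mulr1.
  + exists 0%N, 0%N, 1%N, 'X_(ord_pred i); split; last exact: edge_order0.
    by rewrite den001 rmorphM /= -!/(var _) (mulKf vS).
  + exists 0%N, 0%N, 0%N, 'X_(ord_pred i); split; last exact: edge_order0.
    by rewrite den000 tofrac1 mulr1.
  + exists 0%N, 0%N, 1%N, 'X_(ordS i); split; last exact: edge_order0.
    by rewrite den001 rmorphM /= -!/(var _) mulrC (mulfK vP).
- exists (L + L1)%N, (M + M1)%N, (M' + M1')%N,
    (r * den i L1 M1 M1' + r1 * den i L M M'); split.
    rewrite -denM tofracD (tofracM r) (tofracM r1) (tofracM (den _ _ _ _)).
    by rewrite -yE -y1E; ring.
  rewrite addnACA; apply: edge_orderD; first exact: (edge_orderM rP (edge_order_den _ _ _ _)).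
  by rewrite addnC; exact: (edge_orderM r1P (edge_order_den _ _ _ _)).
- exists (L + L1)%N, (M + M1)%N, (M' + M1')%N, (r * r1); split.
    by rewrite -denM (tofracM r) (tofracM (den _ _ _ _)) -yE -y1E; ring.
  by rewrite addnACA; exact: (edge_orderM rP r1P).
Qed.

(** Both sides of p * den = r * (x_1 x_2 x_3)^N are compared in the chart, first at
    the power j + L of s, then at a power of l.  The factor [edge i ^+ M] of
    the denominator cancels, and the power of t is prime to [edge i]. *)
Lemma laurent_mut_divisible i N y p :
  laurent scal (mut i) (var (ordS i)) (var (ord_pred i)) y ->
  y * frac 'X_[diag N] = frac p ->
  forall j e, (j < N)%N -> edge i ^+ (N - j) %| slice i p j e.
Proof.
move=> /laurent_mut_order [L [M [M' [r [rE rP]]]]] pE j e ltjN.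
have key : p * den i L M M' = r * 'X_[diag N].
  apply/eqP; rewrite -tofrac_eq; apply/eqP.
  by rewrite (tofracM p) (tofracM r) -pE -rE; ring.
pose C : {poly {poly K}} := (edge i ^+ M * 'X^M')%:P * 'X^(L + 3 * M + 2 * M').
pose C' : {poly {poly K}} := ('X^N)%:P * 'X^(3 * N).
have := congr1 (chart i) key.
rewrite (mpolyX_cyc _ i) !diagE /den !(rmorphXn, rmorphM).
rewrite chart_exch !chart_var_eq /chart_var !eqxx ordS_neq ord_pred_neq ord_pred_neqS.
have -> : ('X%:P * 'X) ^+ L * ((edge i)%:P * 'X ^+ 3)%:P ^+ M *
    (('X * 'X%:P)%:P * 'X%:P) ^+ M' = 'X^L * C%:P :> {poly {poly {poly K}}}.
  by rewrite /C (exprD _ (L + 3 * M)) (exprD _ L) (exprM _ 3) (exprM _ 2) !(rmorphXn, rmorphM) !exprMn; ring.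
have -> : ('X%:P * 'X) ^+ N * ('X * 'X%:P)%:P ^+ N * 'X%:P ^+ N
   = 'X^N * C'%:P :> {poly {poly {poly K}}}.
  by rewrite /C' (exprM _ 3) !(rmorphXn, rmorphM) !exprMn; ring.
rewrite !mulrA => /(congr1 (fun f : {poly _} => f`_(j + L))).
rewrite !coefMC !coefMXn addnK ltnNge leq_addl /=.
have [q qE] : exists q, (if (j + L < N)%N then 0 else (chart i r)`_(j + L - N)) * C'
    = (edge i ^+ (N - j + M))%:P * q.
  case: ltnP => [_|le_N]; first by exists 0; rewrite mul0r mulr0.
  have [q ->] := rP (j + L - N)%N; exists (q * C'); rewrite -mulrA.
  by congr (_%:P * _); congr (_ ^+ _); lia.
rewrite qE /C => /(congr1 (fun f : {poly _} => f`_(e + (L + 3 * M + 2 * M')))).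
rewrite mulrA coefMXn addnK ltnNge leq_addl /= coefMC coefCM -/(slice i p j e).
rewrite mulrCA (exprD (edge i)) [_ * edge i ^+ M]mulrC -[RHS]mulrA.
move=> /(mulfI (expf_neq0 M (edge_neq0 be al_neq0 i))) E.
rewrite -(@Gauss_dvdpl _ _ 'X^M'); first by rewrite E dvdp_mulIl.
by rewrite coprimep_sym coprimep_Xn_edge.
Qed.

End Criterion.

(** * Divisibility suffices *)

Lemma laurent_gens (A : comNzRingType) (L : fieldType)
    (iota : {rmorphism A -> L}) (u v w : L) (B := laurent iota u v w) :
  [/\ B u, B u^-1, B v, B v^-1 & B w /\ B w^-1].
Proof.
by split; [| | | | split]; apply: subalg_gen; rewrite !inE eqxx ?orbT.
Qed.

Section Terms.
Variables (L : fieldType) (a x v w u : L).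
Hypotheses (x0 : x != 0) (v0 : v != 0) (w0 : w != 0).

(** The next two lemmas rewrite a term of [chart_expansion], divided by
    (x_1 x_2 x_3)^N, with x = x_i, v = x_{i+1}, w = x_{i+2}, u = x_i', so that
    x_i has a nonnegative exponent if N <= j and has disappeared if j < N. *)
Lemma term_ge j N e : (N <= j)%N ->
  a * w ^+ e * (x / w) ^+ j / (x ^+ N * v ^+ N * w ^+ N) =
  a * w ^+ e * w^-1 ^+ j * x ^+ (j - N) * v^-1 ^+ N * w^-1 ^+ N.
Proof.
move=> le_Nj; rewrite exprMn -[in x ^+ j](subnK le_Nj) (exprD x) !exprVn.
by field; rewrite !expf_neq0.
Qed.

Lemma term_lt j N e : (j < N)%N ->
  a * (u * x / w ^+ 3) ^+ (N - j) * w ^+ e * (x / w) ^+ j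
     / (x ^+ N * v ^+ N * w ^+ N) =
  a * u ^+ (N - j) * w^-1 ^+ (3 * (N - j)) * w ^+ e * w^-1 ^+ j
    * v^-1 ^+ N * w^-1 ^+ N.
Proof.
move=> /ltnW ltjN; rewrite !exprMn -[in x ^+ N](subnK ltjN) (exprD x) !exprVn.
by rewrite (exprM w); field; rewrite !expf_neq0.
Qed.

Lemma monomial_chart (b c d : nat) :
  a * x ^+ b * v ^+ c * w ^+ d =
  a * (v / w) ^+ c * w ^+ (b + (c + d)) * (x / w) ^+ b.
Proof. by rewrite !exprMn !exprVn !exprD; field; rewrite !expf_neq0. Qed.

Lemma edge_chart (b : L) :
  a * (v / w) ^+ 3 + b = (a * v ^+ 3 + b * w ^+ 3) / x * x / w ^+ 3.
Proof. by field; rewrite w0 x0. Qed.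

Lemma recover_var : u != 0 -> x = u * x / w ^+ 3 * w ^+ 3 * u^-1.
Proof. by move=> u0; field; rewrite w0 u0. Qed.

End Terms.

Lemma horner_morph_sum (R S : comNzRingType) (f : {rmorphism R -> S}) (u : S)
    (cfu : commr_rmorph f u) (q : {poly R}) :
  horner_morph cfu q = \sum_(b < size q) f q`_b * u ^+ b.
Proof.
rewrite /horner_morph (horner_coef_wide u (size_poly _ _)).
by apply: eq_bigr => b _; rewrite coef_map.
Qed.

Section Sufficient.
Variables (K : fieldType) (al be : 'I_3 -> K).
Hypothesis al_neq0 : forall i, al i != 0.
Implicit Types (p r : {mpoly K[3]}) (m : 'X_{1..3}) (i : 'I_3).
Local Notation F := {fraction {mpoly K[3]}}.
Local Notation edge := (edge al be).
Local Notation frac := (@tofrac {mpoly K[3]}).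
Local Notation chart := (chart K).
Local Notation scal := (scal K).
Local Notation var := (var K).
Local Notation exch := (exch al be).
Local Notation mut := (mut al be).

(** The next three morphisms invert the chart: t = x_{i+1} / x_{i+2},
    l = x_{i+2}, s = x_i / x_{i+2}. *)
Definition ev_t i : {rmorphism {poly K} -> F} :=
  horner_morph (fun c => mulrC (var (ordS i) / var (ord_pred i)) (scal c)).

Definition ev_l i : {rmorphism {poly {poly K}} -> F} :=
  horner_morph (fun c => mulrC (var (ord_pred i)) (ev_t i c)).

Definition ev_s i : {rmorphism {poly {poly {poly K}}} -> F} :=
  horner_morph (fun c => mulrC (var i / var (ord_pred i)) (ev_l i c)).

Lemma ev_tC i c : ev_t i c%:P = scal c. Proof. exact: horner_morphC. Qed.
Lemma ev_tX i : ev_t i 'X = var (ordS i) / var (ord_pred i).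
Proof. exact: horner_morphX. Qed.
Lemma ev_lC i c : ev_l i c%:P = ev_t i c. Proof. exact: horner_morphC. Qed.
Lemma ev_lX i : ev_l i 'X = var (ord_pred i). Proof. exact: horner_morphX. Qed.
Lemma ev_sC i c : ev_s i c%:P = ev_l i c. Proof. exact: horner_morphC. Qed.
Lemma ev_sX i : ev_s i 'X = var i / var (ord_pred i).
Proof. exact: horner_morphX. Qed.

Lemma frac_monomial i (c : K) m : frac (c *: 'X_[m]) =
  scal c * var i ^+ m i * var (ordS i) ^+ m (ordS i) *
  var (ord_pred i) ^+ m (ord_pred i).
Proof.
by rewrite -mul_mpolyC (mpolyX_cyc _ _ i) !tofracM !tofracXn !mulrA.
Qed.

Lemma frac_sum p :
  frac p = \sum_(m <- msupp p) frac (p@_m *: 'X_[m]).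
Proof. by rewrite {1}[p]mpolyE rmorph_sum. Qed.

Lemma ev_s_chart i p : ev_s i (chart i p) = frac p.
Proof.
transitivity (ev_s i (chart i (\sum_(m <- msupp p) p@_m *: 'X_[m]))).
  by rewrite -mpolyE.
rewrite frac_sum (rmorph_sum (chart i)) (rmorph_sum (ev_s i)).
apply: eq_bigr => m _; rewrite -/(chart i).
rewrite chartZX (frac_monomial i) -!mul_polyC.
rewrite (rmorphM (ev_s i)) (rmorphXn (ev_s i)) ev_sX ev_sC.
rewrite (rmorphM (ev_l i)) (rmorphXn (ev_l i)) ev_lX ev_lC.
rewrite (rmorphM (ev_t i)) (rmorphXn (ev_t i)) ev_tX ev_tC.
by rewrite (mdeg_cyc _ i); apply/esym/monomial_chart; apply: var_neq0.
Qed.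

Lemma chart_expansion i p :
  frac p = \sum_(j < size (chart i p)) (\sum_(e < size (chart i p)`_j)
     ev_t i (slice i p j e) * var (ord_pred i) ^+ e)
       * (var i / var (ord_pred i)) ^+ j.
Proof.
rewrite -(ev_s_chart i) [LHS]horner_morph_sum; apply: eq_bigr => j _.
by congr (_ * _); rewrite [LHS]horner_morph_sum.
Qed.

Lemma frac_exch i : frac (exch i) =
  scal (al i) * var (ordS i) ^+ 3 + scal (be i) * var (ord_pred i) ^+ 3.
Proof.
rewrite /exch -!mul_mpolyC tofracD (tofracM (al i)%:MP) (tofracM (be i)%:MP).
by rewrite !tofracXn.
Qed.

Lemma ev_edge i : ev_t i (edge i) = mut i * var i / var (ord_pred i) ^+ 3.
Proof.
rewrite /mut frac_exch -edge_chart ?var_neq0 // /edge -mul_polyC.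
rewrite (rmorphD (ev_t i)) (rmorphM (ev_t i)) (rmorphXn (ev_t i)).
by rewrite ev_tX !ev_tC.
Qed.

(** In [chart_expansion] the factor [edge i ^+ (N - j)] of a slice evaluates to a
    power of x_i' x_i, which absorbs the negative power of x_i. *)
Lemma divisible_laurent_mut i N y p :
  (forall j e, (j < N)%N -> edge i ^+ (N - j) %| slice i p j e) ->
  y * frac 'X_[diag N] = frac p ->
  laurent scal (mut i) (var (ordS i)) (var (ord_pred i)) y.
Proof.
move=> dv yE.
have yE' : y = frac p / frac 'X_[diag N].
  by rewrite -yE mulfK ?frac_diag_neq0.
have := chart_expansion i p; have := ev_edge i.
have v0 := var_neq0 K (ordS i).
have w0 := var_neq0 K (ord_pred i).
have x0 := var_neq0 K i.
have u0 := mut_neq0 be al_neq0 i.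
rewrite {}yE' (frac_diag _ _ i) {yE}.
set u := mut i in u0 *; set v := var (ordS i) in v0 *.
set w := var (ord_pred i) in w0 *; set x := var i in x0 *.
move=> edgeE ->; set B := laurent scal u v w.
have [Bu BuV Bv BvV [Bw BwV]] := laurent_gens scal u v w.
rewrite -/B in Bu BuV Bv BvV Bw BwV.
have Bexp g n : B g -> B (g ^+ n) by apply: subalg_exp.
have Bmul g h : B g -> B h -> B (g * h) by apply: subalg_mul.
have Bev f : B (ev_t i f).
  rewrite [ev_t i f]horner_morph_sum; apply: subalg_sum => b _.
  by apply: (Bmul); [apply: subalg_scalar | apply: (Bexp); apply: (Bmul)].
have Bx : B x.
  rewrite (recover_var x w0 u0) -edgeE.
  by apply: (Bmul) BuV; apply: (Bmul) (Bev _) _; apply: (Bexp).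
move: (slice i p) dv => sl dv; rewrite mulr_suml.
apply: subalg_sum => j _; rewrite !mulr_suml.
apply: subalg_sum => e _.
case: (leqP N j) => [le_Nj|ltjN].
  rewrite (term_ge _ x0 v0 w0) //.
  by do !apply: (Bmul); try apply: (Bexp); try exact: Bev.
have /dvdpP [q ->] := dv j e ltjN.
rewrite (rmorphM (ev_t i)) (rmorphXn (ev_t i)) edgeE (term_lt _ _ x0 v0 w0) //.
by do !apply: (Bmul); try apply: (Bexp); try exact: Bev.
Qed.

Definition vars_laurent := laurent scal (var (@Ordinal 3 0 isT))
  (var (@Ordinal 3 1 isT)) (var (@Ordinal 3 2 isT)).

Lemma var_cases k :
  [\/ k = @Ordinal 3 0 isT, k = @Ordinal 3 1 isT | k = @Ordinal 3 2 isT].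
Proof.
by case: k => [[|[|[|//]]]] lt;
  [constructor 1 | constructor 2 | constructor 3]; apply: val_inj.
Qed.

Lemma vars_laurentP y :
  vars_laurent y <-> exists N p, y * frac 'X_[diag N] = frac p.
Proof.
have B k : vars_laurent (var k) /\ vars_laurent (var k)^-1.
  have [] := laurent_gens scal (var (@Ordinal 3 0 isT))
    (var (@Ordinal 3 1 isT)) (var (@Ordinal 3 2 isT)).
  by move=> ? ? ? ? []; case: (var_cases k) => ->; split.
have one0 : frac 'X_[diag 0] = 1 by rewrite diag0 mpolyX0 tofrac1.
split; last first.
  case=> N [p yE].
  have -> : y = frac p / frac 'X_[diag N].
    by rewrite -yE mulfK ?frac_diag_neq0.
  rewrite frac_sum (frac_diag _ _ ord0) !invfM -!exprVn.
  have Bexp g n : vars_laurent g -> vars_laurent (g ^+ n) by apply: subalg_exp.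
  have Bmul g h : vars_laurent g -> vars_laurent h -> vars_laurent (g * h).
    exact: subalg_mul.
  apply: (Bmul).
    apply: subalg_sum => m _; rewrite (frac_monomial ord0).
    apply: (Bmul); last exact: Bexp (B _).1.
    apply: (Bmul); last exact: Bexp (B _).1.
    apply: (Bmul); last exact: Bexp (B _).1.
    exact: (subalg_scalar scal).
  apply: (Bmul); last exact: Bexp (B _).2.
  by apply: (Bmul); exact: Bexp (B _).2.
elim=> {y} [a|y|y y' _ [N [p pE]] _ [N' [p' p'E]]
  |y y' _ [N [p pE]] _ [N' [p' p'E]]].
- by exists 0%N, a%:MP; rewrite one0 mulr1.
- have h k : exists N p, var k * frac 'X_[diag N] = frac p.
    by exists 0%N, 'X_k; rewrite one0 mulr1.
  have hV k : exists N p, (var k)^-1 * frac 'X_[diag N] = frac p.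
    exists 1%N, ('X_(ordS k) * 'X_(ord_pred k)).
    by rewrite (frac_diag _ _ k) !expr1 tofracM -mulrA mulKf ?var_neq0.
  rewrite !inE => /or4P[/eqP-> | /eqP-> | /eqP-> | /or3P[/eqP-> | /eqP-> | /eqP->]];
    [exact: h | exact: hV | exact: h | exact: hV | exact: h | exact: hV].
- exists (N + N')%N, (p * 'X_[diag N'] + p' * 'X_[diag N]).
  rewrite diagD mpolyXD tofracD (tofracM p) (tofracM p') tofracM.
  by rewrite -pE -p'E; ring.
- exists (N + N')%N, (p * p').
  by rewrite diagD mpolyXD (tofracM p) tofracM -pE -p'E; ring.
Qed.

End Sufficient.

(** * Finitely generated subalgebras and scalars *)

Lemma laurent_rot (A : comNzRingType) (L : fieldType)
    (iota : {rmorphism A -> L}) (u v w y : L) :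
  laurent iota u v w y -> laurent iota v w u y.
Proof.
apply: subalg_sub => x.
by rewrite !inE => /or4P[-> | -> | -> | /or3P[-> | -> | ->]]; rewrite ?orbT.
Qed.

Lemma subalg_base (A B L : comNzRingType) (f : {rmorphism A -> B})
    (iota : {rmorphism B -> L}) (kappa : {rmorphism A -> L}) (S : L -> Prop) :
  (forall a, kappa a = iota (f a)) ->
  forall y, subalg kappa S y -> subalg iota S y.
Proof.
move=> kE y; elim=> {y} [a|y Sy|x y _ ? _ ?|x y _ ? _ ?].
- by rewrite kE; apply: subalg_scalar.
- exact: subalg_gen.
- exact: subalg_add.
- exact: subalg_mul.
Qed.

Lemma fraction_quotient (A : idomainType) (x : {fraction A}) :
  exists n d : A, d != 0 /\ tofrac d * x = tofrac n.
Proof.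
elim/quotW: x => r; have r2 := denom_ratioP r.
exists (frac r).1, (frac r).2; split=> //.
unlock FracField.tofrac; rewrite !piE; apply/eqmodP.
rewrite /= FracField.equivfE /FracField.mulf.
by rewrite !numden_Ratio ?mul1r ?oner_neq0 // mulr1.
Qed.

(** Elements over Frac(A) are obtained from finitely many scalars. *)
Lemma subalg_clear_denominators (A : idomainType) (L : fieldType)
    (iota : {rmorphism {fraction A} -> L}) (kappa : {rmorphism A -> L})
    (S : L -> Prop) :
  (forall a, kappa a = iota (tofrac a)) ->
  forall y, subalg iota S y ->
    exists2 c : A, c != 0 & subalg kappa S (kappa c * y).
Proof.
move=> kE y; elim=> {y} [x|y Sy|x y _ [c c0 hc] _ [d d0 hd]
  |x y _ [c c0 hc] _ [d d0 hd]].
- have [n [d [d0 E]]] := fraction_quotient x; exists d => //.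
  by rewrite kE -rmorphM E -kE; apply: subalg_scalar.
- exists 1; first exact: oner_neq0.
  by rewrite rmorph1 mul1r; apply: subalg_gen.
- exists (c * d); first by rewrite mulf_neq0.
  rewrite (_ : _ * _ = kappa d * (kappa c * x) + kappa c * (kappa d * y)).
    by apply: subalg_add; apply: subalg_mul => //; apply: subalg_scalar.
  by rewrite rmorphM; ring.
- exists (c * d); first by rewrite mulf_neq0.
  rewrite (_ : _ * _ = (kappa c * x) * (kappa d * y)); first exact: subalg_mul.
  by rewrite rmorphM; ring.
Qed.

Section Poles.
Variable (K : fieldType) (n : nat).
Implicit Types (p : {mpoly K[3]}) (m : 'X_{1..3}) (i : 'I_3).
Local Notation frac := (@tofrac {mpoly K[3]}).

(** For the numerator p of p / (x_1 x_2 x_3)^N: the part of negative degree is 0,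
    the part of degree 0 is constant, and the part of degree 1 has poles of
    order at most n along each x_i = 0. *)
Definition small_poles N p := forall m, m \in msupp p ->
  ((mdeg m <= 3 * N)%N -> forall i, (N <= m i)%N) /\
  ((mdeg m <= 3 * N + 1)%N -> forall i, (N <= m i + n)%N).

Lemma small_poles_mdeg N p m :
  small_poles N p -> m \in msupp p -> (3 * N <= mdeg m)%N.
Proof.
move=> sp mp; case: (leqP (mdeg m) (3 * N)) => [le_m|/ltnW //].
have [/(_ le_m) h _] := sp m mp; rewrite (mdeg_cyc _ ord0).
by have := h ord0; have := h (ordS ord0); have := h (ord_pred ord0); lia.
Qed.

Lemma small_poles_diag N : small_poles N ('X_[diag N]).
Proof.
move=> m; rewrite msuppX inE => /eqP ->.
by split=> _ i; rewrite diagE ?leq_addr.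
Qed.

Lemma small_poles_const c : small_poles 0 (c%:MP).
Proof. by move=> m _; split. Qed.

Lemma small_polesD N p q :
  small_poles N p -> small_poles N q -> small_poles N (p + q).
Proof.
by move=> hp hq m /msuppD_le; rewrite mem_cat => /orP[/hp|/hq].
Qed.

(** In degree at most 1, one of the two factors contributes its part of degree 0,
    which has no poles. *)
Lemma small_polesM N N' p q :
  small_poles N p -> small_poles N' q -> small_poles (N + N') (p * q).
Proof.
move=> hp hq m /msuppM_le /allpairsP [[m1 m2] /= [m1p m2q ->]].
have d1 := small_poles_mdeg hp m1p; have d2 := small_poles_mdeg hq m2q.
have [a1 b1] := hp m1 m1p; have [a2 b2] := hq m2 m2q.
rewrite mdegD; split=> le i; rewrite mnmDE.
  by have := a1 _ i; have := a2 _ i; lia.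
case: (leqP (mdeg m1) (3 * N)) => [le1|lt1].
  by have := a1 le1 i; have := b2 _ i; lia.
by have := b1 _ i; have := a2 _ i; lia.
Qed.

Definition small_poles_elt (y : {fraction {mpoly K[3]}}) :=
  exists N p, y * frac 'X_[diag N] = frac p /\ small_poles N p.

Lemma small_poles_subalg (A : comNzRingType) (f : {rmorphism A -> K})
    (kappa : {rmorphism A -> {fraction {mpoly K[3]}}})
    (S : {fraction {mpoly K[3]}} -> Prop) :
  (forall a, kappa a = scal K (f a)) ->
  (forall y, S y -> small_poles_elt y) ->
  forall y, subalg kappa S y -> small_poles_elt y.
Proof.
move=> kE hS y; elim=> {y} [a|y /hS //
  |x y _ [N [p [pE hp]]] _ [N' [q [qE hq]]]
  |x y _ [N [p [pE hp]]] _ [N' [q [qE hq]]]].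
- exists 0%N, (f a)%:MP; split; last exact: small_poles_const.
  by rewrite kE diag0 mpolyX0 tofrac1 mulr1.
- exists (N + N')%N, (p * 'X_[diag N'] + 'X_[diag N] * q); split.
    rewrite diagD mpolyXD tofracD (tofracM p) (tofracM _ q) tofracM.
    by rewrite -pE -qE; ring.
  apply: small_polesD.
    exact: small_polesM hp (@small_poles_diag N').
  exact: small_polesM (@small_poles_diag N) hq.
- exists (N + N')%N, (p * q); split; last exact: small_polesM.
  by rewrite diagD mpolyXD (tofracM p) tofracM -pE -qE; ring.
Qed.

(** The bound on the poles in degree 1 depends only on the element, not on the
    fraction that represents it. *)
Lemma small_poles_elt_bound y N p m :
  small_poles_elt y -> y * frac 'X_[diag N] = frac p ->
  m \in msupp p -> mdeg m = (3 * N + 1)%N ->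
  forall i, (N <= m i + n)%N.
Proof.
move=> [N' [q [qE hq]]] pE mp dm i.
have E : p * 'X_[diag N'] = q * 'X_[diag N].
  apply/eqP; rewrite -tofrac_eq; apply/eqP.
  by rewrite (tofracM p) (tofracM q) -pE -qE; ring.
have : (diag N' + m)%MM \in msupp (q * 'X_[diag N]).
  by rewrite -E mcoeff_msupp mcoeffMX -mcoeff_msupp.
move=> /(small_polesM hq (@small_poles_diag N)) [_ h].
have := h _ i; rewrite mdegD dm mdeg_diag mnmDE diagE; lia.
Qed.

End Poles.

Lemma small_poles_elt_mono (K : fieldType) n n' (y : {fraction {mpoly K[3]}}) :
  (n <= n')%N -> small_poles_elt n y -> small_poles_elt n' y.
Proof.
move=> le_n [N [p [pE hp]]]; exists N, p; split=> // m /hp [h h']; split=> // le i.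
by apply: leq_trans (h' le i) _; rewrite leq_add2l.
Qed.

Lemma small_poles_seq (K : fieldType) (s : seq {fraction {mpoly K[3]}}) :
  (forall g, g \in s -> exists n, small_poles_elt n g) ->
  exists n, forall g, g \in s -> small_poles_elt n g.
Proof.
elim: s => [|g s IH] h; first by exists 0%N.
have [n hn] := IH (fun g' g's => h g' (mem_behead (s := g :: s) g's)).
have [n' hn'] := h g (mem_head _ _); exists (maxn n n') => g'.
rewrite inE => /predU1P [->|/hn].
  by apply: small_poles_elt_mono hn'; apply: leq_maxr.
by apply: small_poles_elt_mono; apply: leq_maxl.
Qed.


Section Assembly.
Variables (K : fieldType) (al be : 'I_3 -> K).
Hypothesis al_neq0 : forall i, al i != 0.
Hypothesis be_neq0 : forall i, be i != 0.
Hypothesis prod_neq :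
  forall k, (0 < k)%N -> \prod_i al i ^+ k <> \prod_i be i ^+ k.
Local Notation F := {fraction {mpoly K[3]}}.

(** The intersection of Laurent polynomial rings of the theorem, over a field of
    coefficients. *)
Definition upper_bound (y : F) : Prop :=
  vars_laurent y /\ forall i,
    laurent (scal K) (mut al be i) (var K (ordS i)) (var K (ord_pred i)) y.

Lemma upper_bound_small_poles y :
  upper_bound y -> exists n, small_poles_elt n y.
Proof.
case=> /vars_laurentP [N [p pE]] mutL; exists N, N, p; split=> // m mp.
split=> [le_m|_] i; last exact: leq_addl.
apply: (low_degree_bound al_neq0 be_neq0 prod_neq) mp le_m i => i j e.
exact: (laurent_mut_divisible al_neq0 be_neq0 (mutL i) pE).
Qed.

Lemma upper_bound_large_pole N : exists y p m,
  [/\ upper_bound y, y * tofrac 'X_[diag N] = tofrac p, m \in msupp p,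
      mdeg m = (3 * N + 1)%N & m ord0 = 0%N].
Proof.
have [p [dv [m [mp dm m0]]]] := degree_one_element al_neq0 be_neq0 N.
pose y : F := tofrac p / tofrac 'X_[diag N].
have yE : y * tofrac 'X_[diag N] = tofrac p.
  by rewrite divfK // frac_diag_neq0.
exists y, p, m; split=> //; split; first by apply/vars_laurentP; exists N, p.
by move=> i; apply: divisible_laurent_mut yE => // j e; apply: dv.
Qed.

Lemma mutE (i j k : 'I_3) : ordS i = j -> ord_pred i = k ->
  mut al be i =
  (scal K (al i) * var K j ^+ 3 + scal K (be i) * var K k ^+ 3) / var K i.
Proof. by move=> <- <-; rewrite /mut frac_exch. Qed.

End Assembly.

Theorem mainTheorem1 (A : idomainType)
    (a1p a1m a2p a2m a3p a3m : A)
    (ha1p : a1p <> 0) (ha1m : a1m <> 0)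
    (ha2p : a2p <> 0) (ha2m : a2m <> 0)
    (ha3p : a3p <> 0) (ha3m : a3m <> 0)
    (hprod : forall n : nat, (0 < n)%N ->
       a1p ^+ n * a2p ^+ n * a3p ^+ n <> a1m ^+ n * a2m ^+ n * a3m ^+ n) :
  let iota : {rmorphism A -> ratfun3 A} := ratfun3_scalar A in
  let x1 := ratfun3_var A (@Ordinal 3 0 isT) in
  let x2 := ratfun3_var A (@Ordinal 3 1 isT) in
  let x3 := ratfun3_var A (@Ordinal 3 2 isT) in
  let x1' := (iota a1p * x2 ^+ 3 + iota a1m * x3 ^+ 3) / x1 in
  let x2' := (iota a2p * x3 ^+ 3 + iota a2m * x1 ^+ 3) / x2 in
  let x3' := (iota a3p * x1 ^+ 3 + iota a3m * x2 ^+ 3) / x3 in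
  let U := fun y : ratfun3 A =>
    [/\ laurent iota x1 x2 x3 y, laurent iota x1' x2 x3 y,
        laurent iota x1 x2' x3 y & laurent iota x1 x2 x3' y] in
  ~ fin_gen_subalg iota U.
Proof.
move=> iota x1 x2 x3 x1' x2' x3' U [s sU].
pose K : fieldType := {fraction A}.
pose al (i : 'I_3) : K := tofrac (nth 0 [:: a1p; a2p; a3p] i).
pose be (i : 'I_3) : K := tofrac (nth 0 [:: a1m; a2m; a3m] i).
have al_neq0 i : al i != 0.
  by rewrite tofrac_eq0; case: i => [[|[|[|]]]] //= _; apply/eqP.
have be_neq0 i : be i != 0.
  by rewrite tofrac_eq0; case: i => [[|[|[|]]]] //= _; apply/eqP.
have prod_neq k : (0 < k)%N -> \prod_i al i ^+ k <> \prod_i be i ^+ k.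
  move=> /hprod h; rewrite !big_ord_recl !big_ord0 !mulr1 /al /be /= => E.
  apply: h; apply/eqP; rewrite -tofrac_eq !tofracM !tofracXn -!mulrA; exact/eqP.
pose o1 : 'I_3 := @Ordinal 3 0 isT; pose o2 : 'I_3 := @Ordinal 3 1 isT.
pose o3 : 'I_3 := @Ordinal 3 2 isT.
have S1 : ordS o1 = o2 by apply: val_inj.
have S2 : ordS o2 = o3 by apply: val_inj.
have S3 : ordS o3 = o1 by apply: val_inj.
have P1 : ord_pred o1 = o3 by apply: val_inj.
have P2 : ord_pred o2 = o1 by apply: val_inj.
have P3 : ord_pred o3 = o2 by apply: val_inj.
have m1E : mut al be o1 = x1' by rewrite (mutE al be S1 P1).
have m2E : mut al be o2 = x2' by rewrite (mutE al be S2 P2).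
have m3E : mut al be o3 = x3' by rewrite (mutE al be S3 P3).
have iotaE a : iota a = scal K (tofrac a) by [].
have U_upper y : U y -> upper_bound al be y.
  case=> [L0 L1 L2 L3]; split; first exact: (subalg_base iotaE L0).
  have {}L1 : laurent iota (mut al be o1) (var K (ordS o1)) (var K (ord_pred o1)) y.
    rewrite m1E S1 P1.
    exact: L1.
  have {}L2 : laurent iota (mut al be o2) (var K (ordS o2)) (var K (ord_pred o2)) y.
    rewrite m2E S2 P2.
    exact: (laurent_rot L2).
  have {}L3 : laurent iota (mut al be o3) (var K (ordS o3)) (var K (ord_pred o3)) y.
    rewrite m3E S3 P3.
    exact: (laurent_rot (laurent_rot L3)).
  move=> i.
  case: (var_cases i) => ->.
  - exact: (subalg_base iotaE L1).
  - exact: (subalg_base iotaE L2).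
  - exact: (subalg_base iotaE L3).
have upper_U y : upper_bound al be y ->
    exists2 c : A, c != 0 & U (iota c * y).
  case=> L0 L; have := L o3; have := L o2; have := L o1.
  rewrite m1E m2E m3E S1 S2 S3 P1 P2 P3 => {L} L1 L2 L3.
  have L2' := laurent_rot (laurent_rot L2).
  have L3' := laurent_rot L3.
  have [c0 c0nz h0] := subalg_clear_denominators iotaE L0.
  have [c1 c1nz h1] := subalg_clear_denominators iotaE L1.
  have [c2 c2nz h2] := subalg_clear_denominators iotaE L2'.
  have [c3 c3nz h3] := subalg_clear_denominators iotaE L3'.
  (* A product of the four denominators clears them all at once. *)
  exists (c0 * c1 * c2 * c3); first by rewrite !mulf_neq0.
  have mulc (S : ratfun3 A -> Prop) d c : subalg iota S (iota c * y) ->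
      subalg iota S (iota (d * c) * y).
    by move=> h; rewrite rmorphM -mulrA; apply: subalg_mul h; apply: subalg_scalar.
  split.
  - by rewrite (_ : _ * c3 = c1 * c2 * c3 * c0); [apply: mulc | ring].
  - by rewrite (_ : _ * c3 = c0 * c2 * c3 * c1); [apply: mulc | ring].
  - by rewrite (_ : _ * c3 = c0 * c1 * c3 * c2); [apply: mulc | ring].
  - exact: mulc.
(* n bounds the poles in degree 1 of all the generators, so a pole of order
   n + 1 is out of reach. *)
have [n sn] : exists n, forall g, g \in s -> small_poles_elt n g.
  apply: small_poles_seq => g gs.
  apply: (upper_bound_small_poles al_neq0 be_neq0 prod_neq).
  by apply/U_upper/sU; apply: subalg_gen.
have [y [p [m [yU yE mp dm m0]]]] := upper_bound_large_pole al_neq0 be_neq0 n.+1.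
have [c c0 /sU cy] := upper_U y yU.
have cyP := small_poles_subalg iotaE sn cy.
have cyE : iota c * y * tofrac 'X_[diag n.+1] = tofrac ((tofrac c)%:MP * p).
  by rewrite -mulrA yE tofracM.
have := small_poles_elt_bound cyP cyE _ dm ord0.
rewrite m0 add0n ltnn => h; suff: false by []; apply: h.
by rewrite mcoeff_msupp mcoeffCM mulf_neq0 ?tofrac_eq0 // -mcoeff_msupp.
Qed.
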